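(* Let $X$ be a topological space and let $\mathscr{B}$ be a family of covers of $X$ which is Ramseyan and finite-to-one derefinable. Then the following are equivalent: (1) $X$ satisfies $\mathsf{U}_{\mathrm{fin}}(\mathcal{O},\mathscr{B})$. (2) $X$ satisfies $\mathsf{S}_{\mathrm{fin}}(\mathcal{O},\mathcal{O})$, and $\Lambda=\gimel(\mathscr{B})$. (3) ONE has no winning strategy in the game $\mathsf{G}_{\mathrm{fin}}(\Omega,\gimel(\mathscr{B}))$. (4) $X$ satisfies $\mathsf{S}_{\mathrm{fin}}(\Omega,\gimel(\mathscr{B}))$. Moreover, in (3) and (4), $\Omega$ can be replaced by any of $\Lambda$ or $\Gamma$ (i.e., the statements obtained from (3) or (4) by replacing $\Omega$ with $\Lambda$ or with $\Gamma$ are also equivalent to (1)).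
   Context: Convention: a cover of the topological space $X$ is always a countable collection $\mathcal{U}$ of open subsets of $X$ such that $\bigcup\mathcal{U}=X$ and $X\notin\mathcal{U}$. $\mathscr{A},\mathscr{B}$ denote families of such covers of the underlying space $X$. $\mathcal{O}$ is the family of all covers of $X$. $\mathcal{U}$ is a large cover if each $x\in X$ belongs to infinitely many $U\in\mathcal{U}$; $\Lambda$ is the family of all large covers of $X$. $\mathcal{U}$ is an $\omega$-cover if $X\notin\mathcal{U}$ and for each finite $F\subseteq X$ there is $U\in\mathcal{U}$ with $F\subseteq U$; $\Omega$ is the family of all $\omega$-covers of $X$. $\mathcal{U}$ is a $\gamma$-cover if it is infinite and each $x\in X$ belongs to all but finitely many members of $\mathcal{U}$; $\Gamma$ is the family of all $\gamma$-covers of $X$. $\mathscr{A}$ is Ramseyan if for each $\mathcal{U}\in\mathscr{A}$ and each partition of $\mathcal{U}$ into finitely many (equivalently, two) pieces, one of these pieces belongs to $\mathscr{A}$. A cover $\mathcal{V}$ is a finite-to-one derefinement of a cover $\mathcal{U}$ if there is a finite-to-one surjection $f:\mathcal{U}\to\mathcal{V}$ such that $U\subseteq f(U)$ for each $U\in\mathcal{U}$. $\mathscr{A}$ is finite-to-one derefinable if for each $\mathcal{U}\in\mathscr{A}$ and each finite-to-one derefinement $\mathcal{V}\in\mathcal{O}$ of $\mathcal{U}$, $\mathcal{V}\in\mathscr{A}$. A cover $\mathcal{U}$ of $X$ is multifinite if there is a partition of $\mathcal{U}$ into infinitely many finite covers of $X$. $\gimel(\mathscr{A})$ is the family of all covers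 $\mathcal{U}$ of $X$ such that either $\mathcal{U}$ is multifinite, or there is a partition $\mathcal{P}$ of $\mathcal{U}$ into finite sets such that $\{\bigcup\mathcal{F}:\mathcal{F}\in\mathcal{P}\}\setminus\{X\}\in\mathscr{A}$. $\mathsf{S}_{\mathrm{fin}}(\mathscr{A},\mathscr{B})$: for each sequence $\{\mathcal{U}_n\}_{n\in\mathbb{N}}$ of members of $\mathscr{A}$ there are finite subsets $\mathcal{F}_n\subseteq\mathcal{U}_n$, $n\in\mathbb{N}$, such that $\bigcup_n\mathcal{F}_n\in\mathscr{B}$. $\mathsf{U}_{\mathrm{fin}}(\mathscr{A},\mathscr{B})$: for each sequence $\{\mathcal{U}_n\}_{n\in\mathbb{N}}$ of elements of $\mathscr{A}$ which do not contain a finite subcover, there are finite (possibly empty) subsets $\mathcal{F}_n\subseteq\mathcal{U}_n$, $n\in\mathbb{N}$, such that $\{\bigcup\mathcal{F}_n:n\in\mathbb{N}\}\in\mathscr{B}$. $\mathsf{G}_{\mathrm{fin}}(\mathscr{A},\mathscr{B})$ is the game of two players, ONE and TWO, with an inning for each natural number $n$: in the $n$th inning ONE chooses $\mathcal{U}_n\in\mathscr{A}$ and TWO answers with a finite subset $\mathcal{F}_n\subseteq\mathcal{U}_n$. TWO wins if $\bigcup_n\mathcal{F}_n\in\mathscr{B}$; otherwise ONE wins. *)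

(* Defs.v *)
From mathcomp Require Import all_boot all_order.
From mathcomp Require Import all_classical topology.

Set Implicit Arguments.
Unset Strict Implicit.
Unset Printing Implicit Defensive.

Local Open Scope classical_set_scope.

Section Covers.
Variable X : topologicalType.
Implicit Types (U V : set (set X)) (A B : set (set (set X))).

Definition all_covers : set (set (set X)) := [set U |
  [/\ countable U, U `<=` open, \bigcup_(u in U) u = setT & ~ U setT]].

Definition large_covers : set (set (set X)) := [set U |
  all_covers U /\ forall x, infinite_set [set u | U u /\ u x]].

Definition omega_covers : set (set (set X)) := [set U |
  all_covers U /\
  forall F : set X, finite_set F -> exists2 u, U u & F `<=` u].

Definition gamma_covers : set (set (set X)) := [set U |
  [/\ all_covers U, infinite_set U &
      forall x, finite_set [set u | U u /\ ~ u x]]].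

(* [partition P id U] says that P is a set of nonempty, pairwise disjoint
   subsets of U with union U. *)
Definition ramseyan A := forall U P,
  A U -> finite_set P -> partition P id U -> exists2 V, P V & A V.

(* Only the values of f on U matter. *)
Definition finite_to_one_derefinement U V := exists f : set X -> set X,
  [/\ f @` U = V,
      forall v, V v -> finite_set [set u | U u /\ f u = v] &
      forall u, U u -> u `<=` f u].

Definition finite_to_one_derefinable A := forall U V,
  A U -> all_covers V -> finite_to_one_derefinement U V -> A V.

(* U is countable, so infinitely many disjoint pieces can be indexed by nat.
   If X is nonempty, so is every cover of X, and the pieces are nonempty and
   distinct; if X is empty, its only cover, the empty one, is multifinite. *)
Definition multifinite U := exists P : nat -> set (set X),
  [/\ \bigcup_n P n = U, trivIset setT P &
      forall n, finite_set (P n) /\ all_covers (P n)].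

Definition gimel A : set (set (set X)) := [set U |
  all_covers U /\
  (multifinite U \/
   exists P : set (set (set X)),
     [/\ partition P id U, forall F, P F -> finite_set F &
         A ([set \bigcup_(u in F) u | F in P] `\ setT)])].

Definition S_fin A B := forall U : nat -> set (set X),
  (forall n, A (U n)) ->
  exists F : nat -> set (set X),
    (forall n, finite_set (F n) /\ F n `<=` U n) /\ B (\bigcup_n F n).

Definition has_finite_subcover U := exists V,
  [/\ V `<=` U, finite_set V & all_covers V].

Definition U_fin A B := forall U : nat -> set (set X),
  (forall n, A (U n) /\ ~ has_finite_subcover (U n)) ->
  exists F : nat -> set (set X),
    (forall n, finite_set (F n) /\ F n `<=` U n) /\
    B (range (fun n => \bigcup_(u in F n) u)).

(* A strategy for ONE maps the sequence of TWO's answers so far to ONE's next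
   move.  Its values on sequences that cannot arise in a play are irrelevant;
   requiring them in A as well does not affect existence. *)
Definition ONE_strategy A (s : seq (set (set X)) -> set (set X)) :=
  forall h, A (s h).

(* F n is TWO's answer in inning n, and mkseq F n = [:: F 0; ...; F n.-1]. *)
Definition ONE_winning B (s : seq (set (set X)) -> set (set X)) :=
  forall F : nat -> set (set X),
    (forall n, finite_set (F n) /\ F n `<=` s (mkseq F n)) ->
    ~ B (\bigcup_n F n).

Definition ONE_wins_G_fin A B := exists s, ONE_strategy A s /\ ONE_winning B s.

End Covers.

Arguments all_covers : clear implicits.
Arguments large_covers : clear implicits.
Arguments omega_covers : clear implicits.
Arguments gamma_covers : clear implicits.

(* Main.v *)
Require Import Defs.
From mathcomp Require Import all_boot all_order.
From mathcomp Require Import all_classical topology.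
From mathcomp Require Import finmap zify.

Set Implicit Arguments.
Unset Strict Implicit.
Unset Printing Implicit Defensive.

Local Open Scope classical_set_scope.

(** Why the theorem holds.

    Every statement about [omega_covers] or [large_covers] implies the
    selection principle for [gamma_covers], since gamma-covers are
    omega-covers and omega-covers are large, and a game that ONE does not win
    yields the selection principle ([S_fin_of_game]).  So three implications
    remain.

    From S_fin(Gamma, gimel B) to U_fin(O, B) ([U_fin_of_gamma]).  If no
    [U n] has a finite subcover, the finite initial unions of [U n] form an
    increasing sequence [V n], and the sets [V 0 k `&` ... `&` V n k],
    for k in nat, form a gamma-cover.  A finite union of sets selected from
    these gamma-covers lies in a single [V 0 k], hence is not X; so the
    selected family cannot be multifinite, and it has a partition into finite
    sets whose unions form a member of B.  All but finitely many of these
    unions are finite unions of sets selected at stages n or later, thus lie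
    in some [V n k].  Assigning them to suitable n, one derefines that member
    of B to a family of sets [V n (k n)] ([derefine_into_increasing]).

    From U_fin(O, B) to S_fin(O, O) and Lambda = gimel B.  Members of B are
    large because B is Ramseyan, which gives one inclusion
    ([gimel_large]).  For the other, let U be large and enumerated.  If each
    tail of U has a finite subcover, U is multifinite
    ([multifinite_of_tails]).  Otherwise U_fin applied to the tails gives
    finite sets [F n] in the n-th tail whose unions form a member of B.  Cut
    nat into intervals so long that, for n in one of them, [F n] lies within
    that interval and the next.  By the Ramsey property one may keep only the
    n in intervals of a fixed parity; joining each such interval to the next
    one partitions U into finite sets, whose unions derefine the kept part of
    the member of B ([gimel_of_tail_selection]).

    From S_fin(O, O) and Lambda = gimel B to the games ([no_winning_large]).
    This is the theorem of Hurewicz that ONE does not win the Menger game, in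
    a form for large covers.  Let TWO answer only with finite initial parts of
    ONE's moves, so that a position is a finite sequence of numbers.  For
    each m and n, the points covered m times at all positions of length n,
    apart from the finitely many whose entries are below k, form an open set
    that increases to X with k ([level_core_open], [level_core_cover]).
    S_fin(O, O) selects a k for each n, and a play that avoids the finitely
    many exceptional positions covers every point m times for each m
    ([menger_branch]). *)

(** * Finite sets and intervals of natural numbers *)

Lemma finite_nat_bounded (A : set nat) : finite_set A -> exists b, A `<=` `I_b.
Proof.
move=> /finite_seqP[s ->]; exists (\max_(i <- s) i).+1 => i /= si.
by rewrite ltnS; apply: (@leq_bigmax_seq _ s predT id).
Qed.

Lemma eventually_finite (T : Type) (E : set T) (P : T -> nat -> Prop) :
    finite_set E ->
    (forall x, E x -> exists k, forall k', k <= k' -> P x k') ->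
  exists k, forall k', k <= k' -> forall x, E x -> P x k'.
Proof.
move=> finE evP.
have /choice[K KP] x : exists k, E x -> forall k', k <= k' -> P x k'.
  by have [/evP[k Pk]|nEx] := pselect (E x); [exists k|exists 0].
have [b Kb] := finite_nat_bounded (finite_image K finE).
exists b => k' bk' x Ex; apply: (KP x Ex); apply: leq_trans bk'.
by apply: ltnW; apply: Kb; exists x.
Qed.

Lemma finite_fibres_below (T : Type) (U : set T) (g : T -> nat) k :
    (forall i, finite_set [set u | U u /\ g u = i]) ->
  finite_set [set u | U u /\ g u < k].
Proof.
move=> fing.
apply: (@sub_finite_set _ _ (\bigcup_(i in `I_k) [set u | U u /\ g u = i])).
  by move=> u [Uu guk]; exists (g u).
by apply: bigcup_finite.
Qed.

Lemma finite_code_fibre (T : Type) (U : set T) (c : T -> nat) i :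
  {in U &, injective c} -> finite_set [set u | U u /\ c u = i].
Proof.
move=> injc; have [[v [Uv cv]]|no] := pselect (exists v, U v /\ c v = i).
  apply: (sub_finite_set _ (finite_set1 v)) => u [Uu cu] /=.
  by apply: injc; [exact: mem_set|exact: mem_set|rewrite cu cv].
by apply: (sub_finite_set _ (finite_set0 T)) => u Uu; apply: no; exists u.
Qed.

Lemma infinite_unbounded (T : Type) (U : set T) (g : T -> nat) a :
    infinite_set U -> (forall i, finite_set [set u | U u /\ g u = i]) ->
  exists2 u, U u & a <= g u.
Proof.
move=> infU fing; apply: contrapT => no; apply: infU.
apply: (sub_finite_set _ (finite_fibres_below a fing)) => u Uu /=.
by split=> //; rewrite ltnNge; apply/negP => au; apply: no; exists u.
Qed.

(** Cutting nat into consecutive intervals a j <= k < a j.+1, where any condition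
    [R] that holds for all long enough intervals can be imposed; [blk k] is the
    index j of the interval that contains [k], which is what the Galois
    connection between [a] and [blk] amounts to. *)
Lemma interval_blocks (R : nat -> nat -> Prop) :
    (forall a, exists b, forall b', b <= b' -> R a b') ->
  exists a blk : nat -> nat,
    [/\ forall j, j <= a j, forall j, R (a j) (a j.+1) &
        forall j k, (j <= blk k) = (a j <= k)].
Proof.
move=> /choice[b bP].
pose a := fix a j := if j is i.+1 then maxn (a i).+1 (b (a i)) else 0.
have a_lt j : a j < a j.+1 by rewrite /= leq_maxl.
have a_homo : {homo a : i j / i <= j}.
  by apply: homo_leq => [//|x y z|j]; [exact: leq_trans|apply: ltnW].
have le_a j : j <= a j by elim: j => // j IH; apply: leq_ltn_trans (a_lt j).
have ex k : exists j, k < a j.+1.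
  by exists k; apply: leq_ltn_trans (a_lt k).
(* The interval of k is the first one that ends after k. *)
exists a, (fun k => ex_minn (ex k)); split=> //.
  by move=> j; apply: bP; rewrite /= leq_maxr.
move=> j k; case: ex_minnP => i ki imin; apply/idP/idP => [ji|jk].
  apply: leq_trans (a_homo _ _ ji) _; case: i ki imin {ji} => // i ki imin.
  by rewrite leqNgt; apply/negP => /imin; rewrite ltnn.
rewrite leqNgt; apply/negP => ij.
by have := leq_trans ki (leq_trans (a_homo _ _ ij) jk); rewrite ltnn.
Qed.

(** The cells of a partition are recovered from any of their elements. *)
Lemma partition_cell (T : Type) (P : set (set T)) : trivIset P id ->
  exists cell : T -> set T, forall w F, P F -> F w -> cell w = F.
Proof.
move=> trivP; suff /choice[cell cellP] w :
    exists F, forall F', P F' -> F' w -> F = F' by exists cell.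
have [[F [PF Fw]]|no] := pselect (exists F, P F /\ F w).
  by exists F => F' PF' F'w; apply: trivP => //; exists w.
by exists set0 => F' PF' F'w; case: no; exists F'.
Qed.

(** * Menger spaces and the game on large covers *)

Section Topology.
Variable X : topologicalType.
Implicit Types (U V : set (set X)).

Lemma bigcap_open_seq (T : eqType) (s : seq T) (W : T -> set X) :
    (forall t, t \in s -> open (W t)) ->
  open [set x | forall t, t \in s -> W t x].
Proof.
elim: s => [|t s IH] openW.
  rewrite [X in open X](_ : _ = setT); first exact: openT.
  by apply/seteqP; split.
rewrite [X in open X](_ : _ = W t `&` [set x | forall t, t \in s -> W t x]).
  apply: openI; first by apply: openW; rewrite mem_head.
  by apply: IH => t' t's; apply: openW; rewrite in_cons t's orbT.
apply/seteqP; split=> x /=.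
  by move=> Wx; split=> [|t' t's]; apply: Wx; rewrite in_cons ?eqxx // t's orbT.
by move=> [Wtx Wx] t'; rewrite in_cons => /predU1P[->|/Wx].
Qed.

Lemma finite_short_seqs k n : exists s : seq (seq nat),
  forall t, (size t == n) && all (gtn k) t = (t \in s).
Proof.
elim: n => [|n [s sP]].
  by exists [:: [::]] => -[|i t]; rewrite ?in_cons.
exists [seq i :: t | i <- iota 0 k, t <- s] => -[|i t] /=.
  by apply/esym/negbTE/allpairsP => -[[? ?] []].
rewrite eqSS andbCA sP; apply/andP/allpairsP => /=.
  by move=> [ik ts]; exists (i, t); rewrite mem_iota.
by move=> [[j t'] /= [js t's [-> ->]]]; rewrite mem_iota in js.
Qed.

Lemma cover_point U x : all_covers X U -> exists2 u, U u & u x.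
Proof.
by move=> [_ _ covU _]; have : [set: X] x by []; rewrite -covU => -[u]; exists u.
Qed.

(** The property of Menger for increasing open covers; contrary to the members
    of [all_covers], these may contain the whole space. *)
Lemma menger_increasing (W : nat -> nat -> set X) :
    S_fin (all_covers X) (all_covers X) ->
    (forall n k, open (W n k)) ->
    (forall n, {homo W n : k k' / k <= k' >-> k `<=` k'}) ->
    (forall n x, exists k, W n k x) ->
  exists kappa, forall x, exists n, W n (kappa n) x.
Proof.
move=> SX openW homoW covW.
have [[n [k WT]]|noT] := pselect (exists n k, W n k = setT).
  by exists (fun=> k) => x; exists n; rewrite WT.
have WC n : all_covers X (range (W n)).
  split=> [|_ [k _ <-]||[k _ WT]] //.
  - exact: card_image_le.
  - apply/seteqP; split=> // x _; have [k Wx] := covW n x.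
    by exists (W n k) => //; exists k.
  - by apply: noT; exists n, k.
have [F [FP covF]] := SX _ WC.
have /choice[kappa kP] n : exists k, forall w, F n w -> w `<=` W n k.
  have [||k kP] := @eventually_finite _ (F n) (fun w k => w `<=` W n k).
  - by have [] := FP n.
  - move=> w Fw; have [_ /(_ _ Fw)[k _ <-]] := FP n.
    by exists k => k'; apply: homoW.
  - by exists k; apply: kP.
exists kappa => x; have [w [n _ Fw] wx] := cover_point x covF.
by exists n; apply: kP wx.
Qed.

(** The first [n] values of [f], latest first: a position of a play. *)
Fixpoint branch (f : nat -> nat) n : seq nat :=
  if n is i.+1 then f i :: branch f i else [::].

Lemma size_branch f n : size (branch f n) = n.
Proof. by elim: n => //= n ->. Qed.

(** [T p] is the open set secured by TWO at position [p], whose last answer is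
    the head of [p]; the answer 0 brings nothing new. *)
Section Tree.
Variable T : seq nat -> set X.
Hypothesis T_open : forall s, open (T s).
Hypothesis T0 : forall s, T (0 :: s) = T s.
Hypothesis T_homo : forall s, {homo (fun k => T (k :: s)) : k k' / k <= k' >-> k `<=` k'}.
Hypothesis T_cov : forall s x, exists k, T (k :: s) x.

(** Only finitely many positions of length [n] have all entries below [k], so
    this is an intersection over cofinitely many positions. *)
Definition level_core n k : set X :=
  [set x | forall s, size s = n -> has (leq k) s -> T s x].

Lemma level_core_homo n : {homo level_core n : k k' / k <= k' >-> k `<=` k'}.
Proof.
move=> k k' kk' x xP s sn /hasP[i si k'i].
by apply: xP => //; apply/hasP; exists i => //; apply: leq_trans k'i.
Qed.

Lemma tree_child s k : T s `<=` T (k :: s).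
Proof. by rewrite -T0; apply: T_homo. Qed.

Lemma all_gtnN k (s : seq nat) : all (gtn k) s = ~~ has (leq k) s.
Proof. by rewrite -all_predC; apply: eq_all => i /=; rewrite -ltnNge. Qed.

(** An infinite intersection that is open nevertheless: among the children of a
    position outside the finite exceptional set, the one with answer 0 is least
    and equal to its parent, so these contribute the core of the previous level;
    among the children of each of the finitely many exceptional positions, only
    those with answer at least [k] matter, and [k] gives the least. *)
Lemma level_core_open n k : open (level_core n k).
Proof.
elim: n => [|n IH].
  rewrite [X in open X](_ : _ = setT); first exact: openT.
  by apply/seteqP; split=> // x _ [].
have [D DP] := finite_short_seqs k n.
rewrite [X in open X](_ : _ = level_core n k `&`
  [set x | forall t, t \in D -> T (k :: t) x]).
  by apply: openI IH _; apply: bigcap_open_seq.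
apply/seteqP; split=> x /=.
  move=> xP; split=> [s sn sk|t].
    by rewrite -T0; apply: xP => /=; [rewrite sn|rewrite sk orbT].
  by rewrite -DP => /andP[/eqP tn _]; apply: xP; rewrite /= ?tn // leqnn.
move=> [xn xD] [//|j t] [tn] jt.
have [tk|tk] := boolP (has (leq k) t); first by apply: tree_child; apply: xn.
move: jt => /=; rewrite (negbTE tk) orbF => kj; apply: T_homo kj _ _.
by apply: xD; rewrite -DP tn eqxx all_gtnN.
Qed.

(** If [x] is in the core of level [n] for the threshold [k0], only the finitely
    many positions with entries below [k0] can require a greater threshold on
    the next level. *)
Lemma level_core_cover n x : exists k, level_core n k x.
Proof.
elim: n => [|n [k0 xk0]]; first by exists 0 => -[].
have [D DP] := finite_short_seqs k0 n.
have [||k1 k1P] := @eventually_finite _ [set` D] (fun t k => T (k :: t) x).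
- by apply/finite_seqP; exists D.
- by move=> t _; have [k kx] := T_cov t x; exists k => k' /T_homo; apply.
exists (maxn k0 k1) => -[//|j t] [tn] jt.
have [tk|tk] := boolP (has (leq k0) t); first by apply: tree_child; apply: xk0.
move: jt => /= /orP[|/hasP[i ti]]; rewrite geq_max => /andP[k0j k1j].
  by apply: k1P => //=; rewrite -DP tn eqxx all_gtnN.
by move/hasP: tk; case; exists i.
Qed.
End Tree.

(** For each [m], the property of Menger is applied to the levels after [m]
    only, so that each level has to respect finitely many thresholds, those of
    the [m] up to it, and a single branch can respect them all. *)
Lemma menger_branch (T : nat -> seq nat -> set X) :
    S_fin (all_covers X) (all_covers X) ->
    (forall m s, open (T m s)) ->
    (forall m s, T m (0 :: s) = T m s) ->
    (forall m s, {homo (fun k => T m (k :: s)) : k k' / k <= k' >-> k `<=` k'}) ->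
    (forall m s x, exists k, T m (k :: s) x) ->
  exists f, forall m x, exists n, T m (branch f n) x.
Proof.
move=> SX T_open T0 T_homo T_cov.
have /choice[kappa kP] m : exists kappa : nat -> nat, forall x, exists n,
    level_core (T m) (m + n).+1 (kappa n) x.
  apply: (@menger_increasing (fun n k => level_core (T m) (m + n).+1 k)) => //.
  - by move=> n k; apply: level_core_open.
  - by move=> n; apply: level_core_homo.
  - by move=> n; apply: level_core_cover.
exists (fun i => \max_(m < i.+1) kappa m (i - m)) => m x.
have [n xn] := kP m x; exists (m + n).+1; apply: xn; first exact: size_branch.
rewrite /=; apply/orP; left.
have mP : m < (m + n).+1 by rewrite ltnS leq_addr.
apply: leq_trans (leq_bigmax (Ordinal mP)).
by rewrite /= addKn.
Qed.

(** TWO answers a move of ONE by the sets in it whose code is less than a chosen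
    number; the codes are to be injective on every move. *)
Section Game.
Variable s : seq (set (set X)) -> set (set X).
Variable c : seq (set (set X)) -> set X -> nat.

Definition pick k h : set (set X) := [set u | s h u /\ c h u < k].

Fixpoint answers (p : seq nat) : seq (set (set X)) :=
  if p is k :: q then rcons (answers q) (pick k (answers q)) else [::].

Fixpoint picked (p : seq nat) : set (set X) :=
  if p is k :: q then picked q `|` pick k (answers q) else set0.

Definition covered_times m p : set X := [set x | exists2 D : {fset set X},
  (m <= #|` D|)%N & forall u, u \in D -> picked p u /\ u x].
End Game.

(** Counting how often a point is covered turns largeness of the outcome into
    countably many covering conditions, one for each [m], which a single play
    meets. *)
Lemma no_winning_large A B :
    A `<=` large_covers X -> large_covers X `<=` B ->
    S_fin (all_covers X) (all_covers X) -> ~ ONE_wins_G_fin A B.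
Proof.
move=> AL LB SX [s [sA sW]].
have sC h : all_covers X (s h) by have /AL[] := sA h.
have sL h x : infinite_set [set u | s h u /\ u x] by have /AL[_] := sA h; apply.
have /choice[c cinj] h : exists c : set X -> nat, {in s h &, injective c}.
  by apply/countable_injP; have [] := sC h.
have picked_open p u : picked s c p u -> open u.
  elim: p => //= k q IH [/IH //|[hu _]].
  by have [_ sO _ _] := sC (answers s c q); apply: sO.
have [||||f fP] := @menger_branch (covered_times s c) SX.
- move=> m p; rewrite [X in open X](_ : _ =
    \bigcup_(D in [set D : {fset set X} | (m <= #|` D|)%N /\
                   forall u, u \in D -> picked s c p u])
      [set x | forall u, u \in enum_fset D -> u x]).
    by apply: bigcup_open => D [_ DP]; apply: bigcap_open_seq => u /DP/picked_open.
  apply/seteqP; split=> x.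
    by move=> [D mD DP]; exists D; [split=> // u /DP[]|move=> u /DP[]].
  by move=> [D [mD DP] xD]; exists D => // u uD; split; [exact: DP|exact: xD].
- move=> m p; have p0 : picked s c (0 :: p) = picked s c p.
    by apply/seteqP; split=> [u [//|[]//]|u pu]; left.
  by rewrite /covered_times p0.
- move=> m p k k' kk' x [D mD DP]; exists D => // u /DP[[pu|[su cu]] ux].
    by split=> //; left.
  by split=> //; right; split=> //; apply: leq_trans kk'.
- move=> m p x; have [D DP mD] := infinite_set_fset m (sL (answers s c p) x).
  have [||k kP] := @eventually_finite _ [set` D] (fun u k => c (answers s c p) u < k).
  + by apply/finite_fsetP; exists D.
  + by move=> u _; exists (c (answers s c p) u).+1.
  exists k, D => // u uD; have [su ux] := DP _ uD.
  by split=> //; right; split=> //; apply: kP.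
pose F n := pick s c (f n) (answers s c (branch f n)).
have FE n : mkseq F n = answers s c (branch f n).
  by elim: n => // n IH; rewrite mkseqS IH.
have FP n : finite_set (F n) /\ F n `<=` s (mkseq F n).
  split; last by rewrite FE => u [].
  by apply: finite_fibres_below => i; apply: finite_code_fibre.
apply: (sW F FP); apply: LB.
have pickedF n : picked s c (branch f n) `<=` \bigcup_n F n.
  elim: n => //= n IH u [/IH //|]; by exists n.
split; last first.
  move=> x; apply/infinite_set_fsetP => m; have [n [D mD DP]] := fP m x.
  by exists D => // u uD; have [/pickedF] := DP _ uD.
split.
- by apply: bigcup_countable => // n _; apply: finite_set_countable; case: (FP n).
- by move=> u [n _ [su _]]; have [_ sO _ _] := sC (answers s c (branch f n)); apply: sO.
- apply/seteqP; split=> // x _; have [n [D mD DP]] := fP 1 x.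
  have [u uD] : exists u, u \in D.
    by have [D0|] := fset_0Vmem D; [rewrite D0 cardfs0 in mD|case=> u; exists u].
  by have [/pickedF Fu ux] := DP u uD; exists u.
- by move=> [n _ [su _]]; have [_ _ _] := sC (answers s c (branch f n)); apply.
Qed.

(** * Kinds of covers and selection principles *)

Lemma subcover U V : all_covers X U -> V `<=` U ->
  (forall x, exists2 v, V v & v x) -> all_covers X V.
Proof.
move=> [cU oU _ UT] VU covV; split.
- exact: sub_countable (subset_card_le VU) cU.
- exact: subset_trans oU.
- by apply/seteqP; split=> // x _; have [v Vv vx] := covV x; exists v.
- by move/VU.
Qed.

Lemma bounded_finite_union (W : nat -> set X) (D : set (set X)) :
    {homo W : k k' / k <= k' >-> k `<=` k'} -> finite_set D ->
    (forall w, D w -> exists k, w `<=` W k) ->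
  exists k, \bigcup_(w in D) w `<=` W k.
Proof.
move=> homoW finD Dk.
have [|k kP] := @eventually_finite _ D (fun w k => w `<=` W k) finD.
  move=> w /Dk[k wk]; exists k => k' kk'; apply: subset_trans wk _; exact: homoW.
by exists k => x [w Dw wx]; apply: kP wx.
Qed.

Lemma gamma_increasing (W : nat -> set X) :
    (forall k, open (W k)) -> {homo W : k k' / k <= k' >-> k `<=` k'} ->
    (forall x, exists k, W k x) -> (forall k, W k <> setT) ->
  gamma_covers X (range W).
Proof.
move=> openW homoW covW WT.
split; first split.
- exact: card_image_le.
- by move=> _ [k _ <-].
- by apply/seteqP; split=> // x _; have [k kx] := covW x; exists (W k) => //; exists k.
- by move=> [k _ /WT].
- move=> finW; have [|k] := bounded_finite_union homoW finW.
    by move=> _ [k _ <-]; exists k.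
  move=> Wk; apply: (WT k); apply/seteqP; split=> // x _; apply: Wk.
  by have [i ix] := covW x; exists (W i) => //; exists i.
- move=> x; have [k kx] := covW x.
  apply: (sub_finite_set _ (finite_image W (finite_II k))) => _ [[i _ <-] Wix].
  exists i => //=; rewrite ltnNge; apply/negP => ki.
  by apply: Wix; apply: homoW kx.
Qed.

Lemma gamma_omega : gamma_covers X `<=` omega_covers X.
Proof.
move=> U [covU infU gU]; split=> // F finF; apply: contrapT => no.
apply: infU; apply: sub_finite_set (bigcup_finite finF (fun x _ => gU x)).
move=> u Uu; apply: contrapT => noF; apply: no; exists u => // x Fx.
by apply: contrapT => ux; apply: noF; exists x.
Qed.

(** If only finitely many members contained [x], no member would contain [x]
    together with a point outside each of them. *)
Lemma omega_large : omega_covers X `<=` large_covers X.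
Proof.
move=> U [covU oU]; split=> // x finUx; have [_ _ _ UT] := covU.
have /choice[p pP] u : exists y, U u -> ~ u y.
  have [Uu|] := pselect (U u); last by exists x.
  apply: contrapT => no; apply: UT; rewrite (_ : setT = u) //.
  by apply/seteqP; split=> // y _; apply: contrapT => uy; apply: no; exists y.
have [|u Uu xu] := oU (x |` p @` [set u | U u /\ u x]).
  by rewrite finite_setU; split; [exact: finite_set1|exact: finite_image].
apply: (pP u Uu); apply: (xu); right; exists u => //; split=> //.
by apply: xu; left.
Qed.

Lemma S_fin_sub A A' B : A' `<=` A -> @S_fin X A B -> S_fin A' B.
Proof. by move=> A'A SA U UA; apply: SA => n; apply: A'A. Qed.

(** If a sequence refutes the selection principle, ONE wins by playing it
    whatever TWO answers. *)
Lemma S_fin_of_game A B : ~ @ONE_wins_G_fin X A B -> S_fin A B.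
Proof.
move=> noW U UA; apply: contrapT => noF; apply: noW.
exists (fun h => U (size h)); split=> [h|F FP BF]; first exact: UA.
by apply: noF; exists F; split=> // n; have := FP n; rewrite size_mkseq.
Qed.

End Topology.

(** * Ramseyan and derefinable families *)

Section Family.
Variables (X : topologicalType) (B : set (set (set X))).
Hypothesis B_covers : B `<=` all_covers X.
Hypothesis B_ramsey : ramseyan B.
Hypothesis B_deref : finite_to_one_derefinable B.
Implicit Types (U V : set (set X)).

(** A colour class is named by one of its elements, so it is not empty. *)
Lemma ramsey_coloring (C : Type) (c : set X -> C) U :
    B U -> finite_set (c @` U) ->
  exists2 u, U u & B [set v | U v /\ c v = c u].
Proof.
move=> BU finc.
have [|V] := B_ramsey BU
    (finite_image (fun t => [set v | U v /\ c v = t]) finc).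
  split.
  - apply/seteqP; split=> [v [_ [_ _ <-]] []//|v Uv].
    by exists [set w | U w /\ c w = c v] => //; exists (c v) => //; exists v.
  - by move=> _ _ [t _ <-] [t' _ <-] [v [[/= _ <-] [/= _ <-]]].
  - by move=> _ [_ [v Uv <-] <-]; exists v.
by move=> [_ [u Uu <-] <-] BV; exists u.
Qed.

(** Colour [V] by one colour and the finitely many other members of [U] each by
    its own: a singleton class in [B] would be a cover, hence would contain the
    whole space. *)
Lemma B_cofinite U V : B U -> V `<=` U -> finite_set (U `\` V) -> B V.
Proof.
move=> BU VU finUV.
have [|u Uu] := @ramsey_coloring _ (fun u => if `[< V u >] then None else Some u) U BU.
  apply: (@sub_finite_set _ _ (None |` Some @` (U `\` V))).
    by move=> _ [u Uu <-]; case: asboolP => Vu; [left|right; exists u].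
  by rewrite finite_setU; split; [exact: finite_set1|exact: finite_image].
case: asboolP => Vu.
  rewrite [X in B X](_ : _ = V) //; apply/seteqP; split=> v.
    by move=> [_]; case: asboolP.
  by move=> Vv; split; [exact: VU|case: asboolP].
move=> /B_covers /[dup] covu [_ _ _]; case; split.
  rewrite (_ : setT = u) //; apply/seteqP; split=> // x _.
  by have [v [_]] := cover_point x covu; case: asboolP => // _ [->].
suff -> : setT = u by case: asboolP.
apply/seteqP; split=> // x _.
by have [v [_]] := cover_point x covu; case: asboolP => // _ [->].
Qed.

Lemma B_infinite U : B U -> infinite_set U.
Proof.
move=> BU finU; have B0 : B set0 by apply: (B_cofinite BU) => //; rewrite setD0.
by have [|u []] := @ramsey_coloring _ id set0 B0; rewrite image_id.
Qed.

(** The members that miss [x] do not form a cover. *)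
Lemma B_large U x : B U -> infinite_set [set u | U u /\ u x].
Proof.
move=> BU finx; have : B [set u | U u /\ ~ u x].
  apply: (B_cofinite BU) => [u []//|]; apply: sub_finite_set finx.
  by move=> u [Uu /= nu]; split=> //; apply: contrapT => ux; apply: nu.
by move=> /B_covers /(cover_point x)[u []].
Qed.

(** The map [W \o g] is a derefinement as soon as [g] and [W] are
    finite-to-one.  Where it takes the value X, only finitely many members of
    [U] are lost. *)
Lemma derefine_indexed U (g : set X -> nat) (W : nat -> set X) :
    B U -> (forall i, open (W i)) ->
    (forall i, finite_set [set u | U u /\ g u = i]) ->
    (forall i, exists2 u, U u & g u = i) ->
    (forall w, finite_set [set i | W i = w]) ->
    (forall u, U u -> u `<=` W (g u)) ->
  B (range W `\ setT).
Proof.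
move=> BU openW fing surjg finW UW.
pose U' := [set u | U u /\ W (g u) <> setT].
have BU' : B U'.
  apply: (B_cofinite BU) => [u []//|].
  apply: sub_finite_set (bigcup_finite (finW setT) (fun i _ => fing i)).
  move=> u [Uu nu]; exists (g u) => //=.
  by apply: contrapT => WT; apply: nu.
have WU' : (W \o g) @` U' = range W `\ setT.
  apply/seteqP; split=> [_ [u [Uu WT] <-]|_ [[i _ <-] WT]].
    by split=> //; exists (g u).
  by have [u Uu gu] := surjg i; exists u; rewrite /= ?gu //; split=> //; rewrite gu.
apply: (B_deref BU'); last exists (W \o g).
  split.
  - rewrite -WU'; apply: sub_countable (card_image_le _ _) _.
    by have [] := B_covers BU'.
  - by move=> _ [[i _ <-] _].
  - apply/seteqP; split=> // x _.
    have [u [Uu WT] ux] := cover_point x (B_covers BU').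
    by exists (W (g u)); [split=> //; exists (g u)|exact: UW].
  - by move=> [_ nT]; apply: nT.
split=> // [w [_ _]|u [Uu _]]; last exact: UW.
apply: sub_finite_set (bigcup_finite (finW w) (fun i _ => fing i)).
by move=> u [[Uu _] uw]; exists (g u).
Qed.

(** Suppose that for each [n] all but finitely many members of [VV] are contained
    in some [V n k].  Send the member with code [i] to [V n (kk n)], where [n] is
    the index of the interval of [i]; for long intervals this makes sense and is
    onto.  The numbers [kk n] are chosen large enough for the finitely many
    members sent to [n], and so that no value is taken infinitely often. *)
Lemma derefine_into_increasing (V : nat -> nat -> set X) VV :
    (forall n k, open (V n k)) ->
    (forall n, {homo V n : k k' / k <= k' >-> k `<=` k'}) ->
    (forall n x, exists k, V n k x) -> (forall n k, V n k <> setT) ->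
    B VV -> (forall v, VV v -> exists k, v `<=` V 0 k) ->
    (forall n, finite_set [set v | VV v /\ ~ exists k, v `<=` V n k]) ->
  exists kk : nat -> nat, B (range (fun n => V n (kk n))).
Proof.
move=> openV homoV covV VT BP VV0 late.
have [cv cvinj] : exists c : set X -> nat, {in VV &, injective c}.
  by apply/countable_injP; have [] := B_covers BP.
pose R a b := (exists2 v, VV v & a <= cv v < b) /\
  forall v, VV v -> b <= cv v -> forall i, i <= a.+1 -> exists k, v `<=` V i k.
have [|a [blk [le_a Ra blkP]]] := @interval_blocks R.
  move=> a.
  have [v VVv av] := infinite_unbounded a (B_infinite BP)
    (fun i => @finite_code_fibre _ _ _ i cvinj).
  pose E := \bigcup_(i in `I_a.+2) [set v | VV v /\ ~ exists k, v `<=` V i k].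
  have finE : finite_set E by apply: bigcup_finite.
  have [|b bP] := @eventually_finite _ _ (fun v b => cv v < b) finE.
    by move=> u _; exists (cv u).+1.
  exists (maxn (cv v).+1 b) => b'; rewrite geq_max => /andP[vb' bb']; split.
    by exists v => //; rewrite av.
  move=> u VVu b'u i ia; apply: contrapT => nob.
  by suff /(bP _ bb') : E u; [rewrite ltnNge b'u|exists i].
pose g v := blk (cv v).
have finishg i : finite_set [set v | VV v /\ g v = i].
  apply: (sub_finite_set _ (@finite_fibres_below _ VV cv (a i.+1) _)).
    by move=> v [VVv gv]; split=> //; rewrite ltnNge -blkP -/(g v) gv ltnn.
  by move=> j; apply: finite_code_fibre.
have gbound v : VV v -> exists k, v `<=` V (g v) k.
  move=> VVv; case gv : (g v) => [|j]; first exact: VV0.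
  have [_] := Ra j; apply=> //; first by rewrite -blkP -/(g v) gv.
  by rewrite ltnS.
(* The points [y (i, l)] with i, l <= n lie in V n (kk n); so V i l can only be
   the value at n if n < maxn i l. *)
have /choice[y yP] p : exists x, ~ V p.1 p.2 x.
  apply: contrapT => no; apply: (VT p.1 p.2); apply/seteqP; split=> // x _.
  by apply: contrapT => xV; apply: no; exists x.
have /choice[kk kkP] n : exists k, (forall v, VV v -> g v = n -> v `<=` V n k) /\
    forall i l, i <= n -> l <= n -> V n k (y (i, l)).
  have [|k1 k1P] := @eventually_finite _ _ (fun v k => v `<=` V n k) (finishg n).
    move=> v [VVv <-]; have [k vk] := gbound v VVv.
    by exists k => k' kk'; apply: subset_trans vk (homoV _ _ _ kk').
  have [||k2 k2P] := @eventually_finite _ (`I_n.+1 `*` `I_n.+1)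
      (fun p k => V n k (y p)).
  - exact: finite_setX.
  - by move=> p _; have [k kp] := covV n (y p); exists k => k' /homoV; apply.
  exists (maxn k1 k2); split=> [v VVv gv|i l ni nl].
    by apply: k1P; rewrite ?leq_maxl.
  by apply: (k2P _ _ (i, l)); rewrite ?leq_maxr.
exists kk; have -> : range (fun n => V n (kk n)) =
    range (fun n => V n (kk n)) `\ setT.
  by rewrite setDidl //; apply/seteqP; split=> // w [[n _ <-] /VT].
apply: (@derefine_indexed VV g) => //.
- move=> i; have [[v VVv /andP[av va]] _] := Ra i; exists v => //.
  by apply/eqP; rewrite eqn_leq leqNgt !blkP -ltnNge va av.
- move=> w; have [[i <-]|no] := pselect (exists i, V i (kk i) = w); last first.
    by apply: (sub_finite_set _ (finite_set0 nat)) => i iw; apply: no; exists i.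
  apply: (sub_finite_set _ (finite_II (maxn i (kk i)))) => j /= ji.
  rewrite ltnNge geq_max; apply/negP => /andP[ij kj].
  by have [_ /(_ i (kk i) ij kj)] := kkP j; rewrite ji; apply: (yP (i, kk i)).
- by move=> v VVv; have [+ _] := kkP (g v); apply.
Qed.

Lemma U_fin_of_gamma : S_fin (gamma_covers X) (gimel B) -> U_fin (all_covers X) B.
Proof.
move=> SG U UP.
have UC n : all_covers X (U n) by case: (UP n).
have /choice[c cinj] n : exists c : set X -> nat, {in U n &, injective c}.
  by apply/countable_injP; have [] := UC n.
pose head n k := [set u | U n u /\ c n u < k].
pose V n k := \bigcup_(u in head n k) u.
have finhead n k : finite_set (head n k).
  by apply: finite_fibres_below => i; apply: finite_code_fibre.
have headU n k : head n k `<=` U n by move=> u [].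
have openV n k : open (V n k).
  by apply: bigcup_open => u [Uu _]; have [_ oU _ _] := UC n; apply: oU.
have homoV n : {homo V n : k k' / k <= k' >-> k `<=` k'}.
  by move=> k k' kk' x [u [Uu uk] ux]; exists u => //; split=> //; apply: leq_trans kk'.
have covV n x : exists k, V n k x.
  by have [u Uu ux] := cover_point x (UC n); exists (c n u).+1, u.
have VT n k : V n k <> setT.
  move=> Vnk; have [_] := UP n; apply; exists (head n k); split=> //.
  apply: (subcover (UC n)) => // x.
  by have : [set: X] x by []; rewrite -Vnk => -[u]; exists u.
pose W n k := [set x | forall i, i \in iota 0 n.+1 -> V i k x].
have WV n k i : i <= n -> W n k `<=` V i k.
  by move=> in_ x; apply; rewrite mem_iota.
(* Every W n k lies in V 0 k, so no finite family of them covers X. *)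
have WG n : gamma_covers X (range (W n)).
  apply: gamma_increasing.
  - by move=> k; apply: bigcap_open_seq.
  - by move=> k k' kk' x xW i /xW; apply: homoV.
  - move=> x.
    have [||k kP] := @eventually_finite _ [set` iota 0 n.+1] (fun i k => V i k x).
    + by apply/finite_seqP; exists (iota 0 n.+1).
    + by move=> i _; have [k kx] := covV i x; exists k => k' /homoV; apply.
    + by exists k; apply: kP.
  - move=> k WT; apply: (VT 0 k); apply/seteqP; split=> // x _.
    by apply: (@WV n k) => //; rewrite WT.
have [G [GP [covG gimG]]] := SG _ WG.
have Gbound i n w : n <= i -> G i w -> exists k, w `<=` V n k.
  move=> ni Gw; have [_ /(_ _ Gw)[k _ <-]] := GP i.
  by exists k; apply: WV.
have fin_bound n (D : set (set X)) : finite_set D ->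
    (forall w, D w -> exists2 i, n <= i & G i w) ->
    exists k, \bigcup_(w in D) w `<=` V n k.
  move=> finD DG; apply: (bounded_finite_union (@homoV n) finD).
  by move=> w /DG[i ni Gw]; apply: Gbound Gw.
case: gimG => [[P [PG _ PP]]|[P [[PG trivP _] finP BP]]].
  have [finP0 covP0] := PP 0.
  have [|k kP] := @fin_bound 0 (P 0) finP0.
    move=> w Pw; have : (\bigcup_n P n) w by exists 0.
    by rewrite PG => -[i _ Gw]; exists i.
  case: (VT 0 k); apply/seteqP; split=> // x _; apply: kP.
  by have [u Pu ux] := cover_point x covP0; exists u.
set VV := _ `\ setT in BP.
have VV0 v : VV v -> exists k, v `<=` V 0 k.
  move=> [[F PF <-] _]; apply: fin_bound; first exact: finP.
  move=> w Fw; have : cover P id w by exists F.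
  by rewrite PG => -[i _ Gw]; exists i.
(* A cell without sets selected before stage n has its union in some V n k, and
   finitely many cells contain one of the finitely many sets selected before. *)
have late n : finite_set [set v | VV v /\ ~ exists k, v `<=` V n k].
  pose E := \bigcup_(i in `I_n) G i.
  have [cell cellP] := partition_cell trivP.
  have finE : finite_set E by apply: bigcup_finite => // i _; case: (GP i).
  apply: sub_finite_set (finite_image (fun w => \bigcup_(u in cell w) u) finE).
  move=> v [[[F PF <-] _] nob].
  have [w [Ew Fw]] : exists w, E w /\ F w.
    apply: contrapT => no; apply: nob; apply: fin_bound; first exact: finP.
    move=> w Fw; have : cover P id w by exists F.
    rewrite PG => -[i _ Gw]; exists i => //; rewrite leqNgt; apply/negP => ni.
    by apply: no; exists w; split=> //; exists i.
  by exists w => //; rewrite (cellP w F).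
have [kk Bkk] := derefine_into_increasing openV homoV covV VT BP VV0 late.
by exists (fun n => head n (kk n)).
Qed.

Lemma S_fin_of_U_fin : U_fin (all_covers X) B -> S_fin (all_covers X) (all_covers X).
Proof.
move=> UB U UC.
have subU (F : nat -> set (set X)) : (forall n, F n `<=` U n) ->
    (forall x, exists n u, F n u /\ u x) -> all_covers X (\bigcup_n F n).
  move=> FU covF; split.
  - apply: bigcup_countable => // n _; have [cU _ _ _] := UC n.
    exact: sub_countable (subset_card_le (FU n)) cU.
  - by move=> u [n _ Fu]; have [_ oU _ _] := UC n; apply: oU; apply: FU.
  - apply/seteqP; split=> // x _; have [n [u [Fu ux]]] := covF x.
    by exists u => //; exists n.
  - by move=> [n _ Fu]; have [_ _ _] := UC n; apply; apply: FU.
have [[n [V [VU finV covV]]]|no] := pselect (exists n, has_finite_subcover (U n)).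
  exists (fun i => if i == n then V else set0); split=> [i|].
    by case: eqP => [->|]; split.
  apply: subU => [i|x]; first by case: eqP => [->//|_]; exact: sub0set.
  by have [u Vu ux] := cover_point x covV; exists n, u; rewrite eqxx.
have [|F [FP BF]] := UB U; first by move=> n; split=> // fn; apply: no; exists n.
exists F; split=> //; apply: subU => [n|x]; first by case: (FP n).
by have [_ [n _ <-] [u Fu ux]] := cover_point x (B_covers BF); exists n, u.
Qed.

(** In a partition into finite covers each piece has a member containing [x].  In
    a partition into finite sets, infinitely many of their unions contain [x], and
    disjoint sets contribute different members containing [x]. *)
Lemma gimel_large : gimel B `<=` large_covers X.
Proof.
move=> U [covU gU]; split=> // x finx.
case: gU => [[P [PU trivP PP]]|[P [[PU trivP _] finP BP]]].
  have /choice[p pP] n : exists u, P n u /\ u x.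
    by have [u Pu ux] := cover_point x (proj2 (PP n)); exists u.
  apply: infinite_nat; apply: (@sub_finite_set _ _
    (\bigcup_(u in [set u | U u /\ u x]) [set n | p n = u])).
    move=> n _; have [Pp px] := pP n; exists (p n) => //; split=> //.
    by rewrite -PU; exists n.
  apply: bigcup_finite => // u _.
  have [[n nu]|no] := pselect (exists n, p n = u); last first.
    by apply: (sub_finite_set _ (finite_set0 nat)) => i iw; apply: no; exists i.
  apply: (sub_finite_set _ (finite_set1 n)) => i /= iu.
  have [Pn _] := pP n; have [Pi _] := pP i.
  by apply: trivP => //; exists u; split; [rewrite -iu|rewrite -nu].
apply: (B_large (x := x) BP).
have [cell cellP] := partition_cell trivP.
apply: sub_finite_set (finite_image (fun w => \bigcup_(u in cell w) u) finx).
move=> v [[[F PF <-] _] [u Fu ux]]; exists u; last by rewrite (cellP u F).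
by split=> //; rewrite -PU; exists F.
Qed.

(** Disjoint finite subcovers can be found one after another, each beyond the
    previous one; the members of [U] in between are absorbed by them. *)
Lemma multifinite_of_tails U (c : set X -> nat) :
    all_covers X U -> {in U &, injective c} ->
    (forall N, has_finite_subcover [set u | U u /\ N <= c u]) ->
  multifinite U.
Proof.
move=> covU cinj fins.
have finlt k : finite_set [set u | U u /\ c u < k].
  by apply: finite_fibres_below => i; apply: finite_code_fibre.
pose R a b := exists V, [/\ V `<=` U, all_covers X V & forall v, V v -> a <= c v < b].
have [|a [blk [_ Ra blkP]]] := @interval_blocks R.
  move=> a; have [V [Vt finV covV]] := fins a.
  have [|b bP] := @eventually_finite _ _ (fun v b => c v < b) finV.
    by move=> u _; exists (c u).+1.
  exists b => b' bb'; exists V; split=> //; first by move=> v /Vt[].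
  by move=> v Vv; have [_ ->] := Vt _ Vv; rewrite (bP b').
exists (fun i => [set u | U u /\ blk (c u) = i]); split.
- apply/seteqP; split=> [u [i _ []//]|u Uu]; by exists (blk (c u)).
- by move=> i j _ _ [u [[_ <-] [_ <-]]].
- move=> i; split.
    apply: (sub_finite_set _ (finlt (a i.+1))).
    by move=> u [Uu ui]; split=> //; rewrite ltnNge -blkP ui ltnn.
  have [V [VU covV Vab]] := Ra i; apply: (subcover covU) => [u []//|x].
  have [v Vv vx] := cover_point x covV; exists v => //; split; first exact: VU.
  have /andP[av va] := Vab v Vv.
  by apply/eqP; rewrite eqn_leq leqNgt !blkP -ltnNge va av.
Qed.

(** The selected sets [F n] are spread over intervals a j <= k < a j.+1 of codes.
    Each of them contains the chosen index of a member of the given element of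
    [B], so that every cell is used; the codes in [F n] lie in the interval of
    [n] or in the next one; and the sets with codes in an interval cover a point
    missed by those with codes from [N0] to the start of the interval, so that
    no set is the union of infinitely many cells. *)
Lemma gimel_of_tail_selection U (c : set X -> nat) N0 (F : nat -> set (set X)) :
    all_covers X U -> (forall x, infinite_set [set u | U u /\ u x]) ->
    {in U &, injective c} ->
    ~ has_finite_subcover [set u | U u /\ N0 <= c u] ->
    (forall n, finite_set (F n) /\
               F n `<=` [set u | U u /\ maxn N0 n <= c u]) ->
    B (range (fun n => \bigcup_(u in F n) u)) ->
  exists P : set (set (set X)),
    [/\ partition P id U, forall D, P D -> finite_set D &
        B ([set \bigcup_(u in D) u | D in P] `\ setT)].
Proof.
move=> covU largeU cinj noN0 FP BF.
have cfib i := @finite_code_fibre _ _ _ i cinj.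
have finlt k : finite_set [set u | U u /\ c u < k] by apply: finite_fibres_below.
set VV := (X in B X) in BF.
have /choice[idx idxP] v : exists n, VV v -> \bigcup_(u in F n) u = v.
  by have [[n _ <-]|no] := pselect (VV v); [exists n|exists 0].
have idxinj : {in VV &, injective idx}.
  move=> v w /set_mem/idxP vE /set_mem/idxP wE vw.
  by rewrite -vE vw.
have idxfib i := @finite_code_fibre _ _ _ i idxinj.
pose R a b := [/\ exists2 v, VV v & a <= idx v < b,
  forall n u, n < a -> F n u -> c u < b &
  exists2 x, (exists2 u, U u /\ u x & a <= c u < b) &
    forall u, U u -> N0 <= c u < a -> ~ u x].
have [|a [blk [le_a Ra blkP]]] := @interval_blocks R.
  move=> a; have [v VVv av] := infinite_unbounded a (B_infinite BF) idxfib.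
  have finE : finite_set (\bigcup_(n in `I_a) F n).
    by apply: bigcup_finite => // n _; case: (FP n).
  have [|b bP] := @eventually_finite _ _ (fun v b => c v < b) finE.
    by move=> u _; exists (c u).+1.
  have [x xP] : exists x, forall u, U u -> N0 <= c u < a -> ~ u x.
    apply: contrapT => no; apply: noN0; exists [set u | U u /\ N0 <= c u < a].
    split; first by move=> u [Uu /andP[]].
      by apply: sub_finite_set (finlt a) => u [Uu /andP[]].
    apply: (subcover covU) => [u []//|x]; apply: contrapT => nox.
    by apply: no; exists x => u Uu ua ux; apply: nox; exists u.
  have [|u [Uu ux] au] := infinite_unbounded (g := c) a (largeU x).
    by move=> i; apply: sub_finite_set (cfib i) => u [[]].
  exists (maxn (idx v).+1 (maxn b (c u).+1)) => b'.
  rewrite !geq_max => /and3P[vb' bb' ub']; split.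
  - by exists v => //; rewrite av.
  - by move=> n w na Fw; apply: bP => //; exists n.
  - by exists x => //; exists u => //; rewrite au.
(* Keep the members whose index lies in an interval of fixed parity [e]. *)
have [|v0 _] := @ramsey_coloring _ (odd \o blk \o idx) _ BF; first exact: finite_finset.
set e := (odd \o blk \o idx) v0; set VE := (X in B X) => BVE.
(* The cell i consists of the intervals 2i+e and 2i+e+1; the truncated
   subtraction puts the interval 0 into the cell 0 when e = 1. *)
pose half k := (blk k - e)./2.
pose piece i := [set u | U u /\ half (c u) = i].
have a_homo : {homo a : i j / i <= j}.
  by move=> i j ij; rewrite -blkP; apply: leq_trans ij _; rewrite blkP.
have half_lt k i : half k = i -> k < a (i.*2 + e).+2.
  by move=> <-; rewrite ltnNge -blkP /half; case: (e); lia.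
have le_half k : half k <= k.
  have : blk k <= k by apply: leq_trans (le_a _) _; rewrite -blkP.
  by rewrite /half; lia.
have halfE k i : a (i.*2 + e) <= k < a (i.*2 + e).+1 -> blk k = i.*2 + e.
  by rewrite -blkP ltnNge -blkP -ltnNge ltnS => /andP[? ?]; lia.
have half_cell k i : a (i.*2 + e) <= k < a (i.*2 + e).+1 -> half k = i.
  by move=> /halfE; rewrite /half => ->; rewrite addnK doubleK.
have finpiece i : finite_set (piece i).
  by apply: sub_finite_set (finlt _) => u [Uu /half_lt ui]; split; last exact: ui.
exists (range piece); split.
- split.
  + apply/seteqP; split=> [u [_ [i _ <-] []]//|u Uu].
    by exists (piece (half (c u))) => //; exists (half (c u)).
  + by move=> _ _ [i _ <-] [j _ <-] [u [[/= _ <-] [/= _ <-]]].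
  + move=> _ [i _ <-]; have [_ _ [x [u [Uu ux] uc] _]] := Ra (i.*2 + e).
    by exists u; split=> //; apply: half_cell.
- by move=> _ [i _ <-].
rewrite image_comp; apply: (@derefine_indexed VE (half \o idx)) => //.
- by move=> i; apply: bigcup_open => u [Uu _]; have [_ oU _ _] := covU; apply: oU.
- move=> i; apply: sub_finite_set (finite_fibres_below (a (i.*2 + e).+2) idxfib).
  by move=> v [[VVv _] /half_lt].
- move=> i; have [[v VVv vi] _ _] := Ra (i.*2 + e); exists v; last exact: half_cell.
  split=> //; rewrite /comp (halfE _ _ vi) oddD odd_double /=; by case: (e).
- have neqW i j : N0 <= i -> i < j ->
      \bigcup_(u in piece i) u <> \bigcup_(u in piece j) u.
    move=> N0i ij ijE; have [_ _ [x [u [Uu ux] uc] xP]] := Ra (j.*2 + e).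
    have : (\bigcup_(u in piece j) u) x.
      by exists u => //; split=> //; apply: half_cell.
    rewrite -ijE => -[w [Uw wi] wx]; apply: (xP w Uw _ wx); apply/andP; split.
      by apply: leq_trans N0i _; rewrite -wi le_half.
    by apply: leq_trans (half_lt _ _ wi) (a_homo _ _ _); lia.
  move=> w; have [[i N0i iw]|no] :=
      pselect (exists2 i, N0 <= i & \bigcup_(u in piece i) u = w).
    apply: (sub_finite_set _ (finite_II i.+1)) => j /= jw.
    by rewrite ltnS leqNgt; apply/negP => /(neqW _ _ N0i); apply; rewrite iw.
  apply: (sub_finite_set _ (finite_II N0)) => j /= jw.
  by rewrite ltnNge; apply/negP => N0j; apply: no; exists j.
- move=> v [VVv ev] x; rewrite -{1}(idxP v VVv) => -[u Fu ux]; exists u => //.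
  have [_ /(_ _ Fu)[Uu]] := FP (idx v); rewrite geq_max => /andP[_ vu].
  split=> //=; have [_ cu _] := Ra (blk (idx v)).+1.
  have {}cu : c u < a (blk (idx v)).+2.
    by apply: (cu (idx v)) => //; rewrite ltnNge -blkP ltnn.
  have lo : blk (idx v) <= blk (c u) by rewrite blkP; apply: leq_trans vu; rewrite -blkP.
  have hi : blk (c u) <= (blk (idx v)).+1 by rewrite leqNgt blkP -ltnNge.
  by move: ev; rewrite /half /comp; case: (e); lia.
Qed.

Lemma large_gimel : U_fin (all_covers X) B -> large_covers X `<=` gimel B.
Proof.
move=> UB U [covU largeU]; split=> //.
have [c cinj] : exists c : set X -> nat, {in U &, injective c}.
  by apply/countable_injP; have [] := covU.
pose tail N := [set u | U u /\ N <= c u].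
have [fins|/existsNP[N0 noN0]] := pselect (forall N, has_finite_subcover (tail N)).
  by left; apply: multifinite_of_tails cinj fins.
have tailC N : all_covers X (tail N).
  apply: (subcover covU) => [u []//|x].
  have [|u [Uu ux] Nu] := infinite_unbounded (g := c) N (largeU x).
    by move=> i; apply: sub_finite_set (finite_code_fibre i cinj) => u [[]].
  by exists u.
have [|F [FP BF]] := UB (fun n => tail (maxn N0 n)).
  move=> n; split=> // -[V [Vt finV covV]]; apply: noN0; exists V; split=> //.
  by move=> v /Vt[Uv]; rewrite geq_max => /andP[].
by right; apply: gimel_of_tail_selection noN0 FP BF.
Qed.

End Family.

(** * The equivalences *)

Theorem theorem6 (X : topologicalType) (B : set (set (set X)))
    (B_covers : B `<=` all_covers X) (B_ramsey : ramseyan B)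
    (B_deref : finite_to_one_derefinable B) :
  [<-> (* 1 *) U_fin (all_covers X) B;
       (* 2 *) S_fin (all_covers X) (all_covers X) /\
               large_covers X = gimel B;
       (* 3 *) ~ ONE_wins_G_fin (omega_covers X) (gimel B);
       (* 4 *) S_fin (omega_covers X) (gimel B);
       (* 3, large *) ~ ONE_wins_G_fin (large_covers X) (gimel B);
       (* 4, large *) S_fin (large_covers X) (gimel B);
       (* 3, gamma *) ~ ONE_wins_G_fin (gamma_covers X) (gimel B);
       (* 4, gamma *) S_fin (gamma_covers X) (gimel B)].
Proof.
have game A : A `<=` large_covers X ->
    S_fin (all_covers X) (all_covers X) /\ large_covers X = gimel B ->
    ~ ONE_wins_G_fin A (gimel B).
  by move=> AL [SX LB]; apply: no_winning_large => //; rewrite LB.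
have of_gamma : S_fin (gamma_covers X) (gimel B) ->
    S_fin (all_covers X) (all_covers X) /\ large_covers X = gimel B.
  move/U_fin_of_gamma => UB; have {}UB := UB B_covers B_ramsey B_deref.
  split; first exact: S_fin_of_U_fin UB.
  by apply/seteqP; split; [exact: large_gimel|exact: gimel_large].
tfae.
- move=> UB; split; first exact: S_fin_of_U_fin UB.
  by apply/seteqP; split; [exact: large_gimel|exact: gimel_large].
- exact: game (@omega_large X).
- exact: S_fin_of_game.
- by move=> /(S_fin_sub (@gamma_omega X)) /of_gamma; apply: game.
- exact: S_fin_of_game.
- move=> /(S_fin_sub (@omega_large X)) /(S_fin_sub (@gamma_omega X)) /of_gamma.
  by apply: game => U /gamma_omega/omega_large.
- exact: S_fin_of_game.
- exact: U_fin_of_gamma.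
Qed.
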